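(* Let $(P,<)$ be the random poset. The automorphism group $\operatorname{Aut}(P,<)$ has no mixed identities (in any finite number $r$ of variables).
   Context: The random poset is the Fraïssé limit of the class of all finite partially ordered sets, i.e. the (up to isomorphism unique) countable partially ordered set that is homogeneous (every isomorphism between finite induced sub-posets extends to an automorphism) and contains a copy of every finite poset as induced substructure. For a group $G$ and the free group $\mathbf F_r=\langle x_1,\dots,x_r\rangle$, a word with constants in $G$ is an element $w\in G\ast\mathbf F_r$. For $g_1,\dots,g_r\in G$, $w(g_1,\dots,g_r)\in G$ denotes the image of $w$ under the homomorphism $G\ast\mathbf F_r\to G$ that is the identity on $G$ and sends $x_i\mapsto g_i$. The word $w$ is a mixed identity for $G$ if $w\neq1$ in $G\ast\mathbf F_r$ and $w(g_1,\dots,g_r)=1_G$ for all $g_1,\dots,g_r\in G$. *)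

(* Defs.v *)
From HB Require Import structures.
From mathcomp Require Import all_boot all_order finmap.
From mathcomp Require Import boolp classical_sets cardinality.

Set Implicit Arguments.
Unset Strict Implicit.
Unset Printing Implicit Defensive.

Import Order.TTheory.

Local Open Scope group_scope.
Local Open Scope order_scope.

(* (x, false) stands for the generator x and (x, true) for its inverse. *)
Definition word (X : Type) := seq (X * bool).

Section Presentation.
Variables (X : choiceType) (R : word X -> word X -> Prop).

Inductive pres_eq : word X -> word X -> Prop :=
| pres_eq_refl u : pres_eq u u
| pres_eq_sym u v : pres_eq u v -> pres_eq v u
| pres_eq_trans v u w : pres_eq u v -> pres_eq v w -> pres_eq u w
| pres_eq_cat u u' v v' :
    pres_eq u u' -> pres_eq v v' -> pres_eq (u ++ v)%SEQ (u' ++ v')%SEQ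
| pres_eq_inv x b : pres_eq [:: (x, b); (x, ~~ b)] [::]
| pres_eq_rel u v : R u v -> pres_eq u v.

Definition pres_eqb (u v : word X) : bool := `[< pres_eq u v >].

Lemma pres_eqb_refl : reflexive pres_eqb.
Proof. by move=> u; apply/asboolP; exact: pres_eq_refl. Qed.

Lemma pres_eqb_sym : symmetric pres_eqb.
Proof. by move=> u v; apply/asboolP/asboolP; exact: pres_eq_sym. Qed.

Lemma pres_eqb_trans : transitive pres_eqb.
Proof.
move=> v u w /asboolP uv /asboolP vw; apply/asboolP.
exact: pres_eq_trans uv vw.
Qed.

Canonical pres_eqb_equiv :=
  EquivRel pres_eqb pres_eqb_refl pres_eqb_sym pres_eqb_trans.

(* The group < X | u = v whenever R u v >. *)
Definition pres : Type := {eq_quot pres_eqb}%qT.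

HB.instance Definition _ := EqQuotient.copy pres {eq_quot pres_eqb}%qT.
HB.instance Definition _ := Choice.copy pres {eq_quot pres_eqb}%qT.

Definition pres_pi (u : word X) : pres := (\pi_pres u)%qT.

Definition pres_gen (x : X) : pres := pres_pi [:: (x, false)].

Definition word_inv (u : word X) : word X := rev [seq (a.1, ~~ a.2) | a <- u].

Definition pres_one : pres := pres_pi [::].
Definition pres_mul (a b : pres) : pres := pres_pi (repr a ++ repr b).
Definition pres_inv (a : pres) : pres := pres_pi (word_inv (repr a)).

Lemma pres_piP u v : pres_pi u = pres_pi v <-> pres_eq u v.
Proof. by split=> [/eqmodP/asboolP|/asboolP uv]; last exact/eqmodP. Qed.

Lemma pres_reprK a : pres_pi (repr a) = a.
Proof. exact: reprK. Qed.

Lemma pres_repr_pi u : pres_eq (repr (pres_pi u)) u.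
Proof. by apply/pres_piP; rewrite pres_reprK. Qed.

Lemma pres_piM u v : pres_mul (pres_pi u) (pres_pi v) = pres_pi (u ++ v).
Proof. by apply/pres_piP; apply: pres_eq_cat; exact: pres_repr_pi. Qed.

Lemma word_invK : involutive word_inv.
Proof.
move=> u; rewrite /word_inv map_rev revK -map_comp -[RHS]map_id.
by apply: eq_map => -[x b] /=; rewrite negbK.
Qed.

Lemma word_mulV u : pres_eq (u ++ word_inv u)%SEQ [::].
Proof.
elim: u => [|[x b] u IHu]; first exact: pres_eq_refl.
have -> : (((x, b) :: u) ++ word_inv ((x, b) :: u) =
    [:: (x, b)] ++ ((u ++ word_inv u) ++ [:: (x, ~~ b)]))%SEQ.
  by rewrite /word_inv /= rev_cons -cats1 !catA.
apply: pres_eq_trans (pres_eq_inv x b).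
rewrite -[X in pres_eq _ X]/([:: (x, b)] ++ ([::] ++ [:: (x, ~~ b)]))%SEQ.
apply: pres_eq_cat; first exact: pres_eq_refl.
by apply: pres_eq_cat; last exact: pres_eq_refl.
Qed.

Lemma word_mulVr u : pres_eq (word_inv u ++ u)%SEQ [::].
Proof. by have := word_mulV (word_inv u); rewrite word_invK. Qed.

Lemma pres_mulA : associative pres_mul.
Proof.
move=> a b c; rewrite -[a]pres_reprK -[b]pres_reprK -[c]pres_reprK.
by rewrite !pres_piM catA.
Qed.

Lemma pres_mul1 : left_id pres_one pres_mul.
Proof. by move=> a; rewrite -[a]pres_reprK pres_piM. Qed.

Lemma pres_mulr1 : right_id pres_one pres_mul.
Proof. by move=> a; rewrite -[a]pres_reprK pres_piM cats0. Qed.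

Lemma pres_mulV : left_inverse pres_one pres_inv pres_mul.
Proof.
move=> a; rewrite -[X in pres_mul _ X]pres_reprK pres_piM.
by apply/pres_piP; exact: word_mulVr.
Qed.

Lemma pres_mulVr : right_inverse pres_one pres_inv pres_mul.
Proof.
move=> a; rewrite -[X in pres_mul X _]pres_reprK pres_piM.
by apply/pres_piP; exact: word_mulV.
Qed.

HB.instance Definition _ := isGroup.Build pres
  pres_mulA pres_mul1 pres_mulr1 pres_mulV pres_mulVr.

Variable K : groupType.

Definition word_val (f : X -> K) (u : word X) : K :=
  \prod_(a <- u) (if a.2 then (f a.1)^-1 else f a.1).

(* The homomorphism extending f : X -> K; meaningful when f satisfies R. *)
Definition pres_lift (f : X -> K) (a : pres) : K := word_val f (repr a).

Definition respects (f : X -> K) : Prop :=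
  forall u v, R u v -> word_val f u = word_val f v.

Lemma word_val_cat f u v : word_val f (u ++ v) = word_val f u * word_val f v.
Proof. exact: big_cat. Qed.

Lemma word_val_eq f u v : respects f -> pres_eq u v -> word_val f u = word_val f v.
Proof.
move=> fR; elim=> {u v} [//|u v _ -> //|v u w _ -> _ -> //||x b|u v /fR //].
- by move=> u u' v v' _ IHu _ IHv; rewrite !word_val_cat IHu IHv.
- by rewrite /word_val !big_cons big_nil mulg1; case: b; rewrite /= (mulVg, mulgV).
Qed.

Lemma pres_lift_pi f u : respects f -> pres_lift f (pres_pi u) = word_val f u.
Proof. by move=> fR; apply: word_val_eq => //; exact: pres_repr_pi. Qed.

Lemma pres_lift_gen f x : respects f -> pres_lift f (pres_gen x) = f x.
Proof. by move=> fR; rewrite pres_lift_pi // /word_val big_seq1. Qed.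

Lemma pres_lift_monoid_morphism f : respects f -> monoid_morphism (pres_lift f).
Proof.
move=> fR; split=> [|a b]; first by rewrite pres_lift_pi // /word_val big_nil.
by rewrite -[a * b]/(pres_mul a b) pres_lift_pi // word_val_cat.
Qed.

Lemma pres_lift_unique f (phi : UMagmaMorphism.type pres K) :
  (forall x, phi (pres_gen x) = f x) -> phi =1 pres_lift f.
Proof.
move=> phif a; rewrite -[a in LHS]pres_reprK /pres_lift /word_val.
elim: (repr a) => [|[x b] u IHu]; first by rewrite big_nil; exact: gmulf1.
rewrite big_cons -IHu.
have -> : pres_pi ((x, b) :: u) = pres_pi [:: (x, b)] * pres_pi u.
  by rewrite -[RHS]/(pres_mul _ _) pres_piM.
rewrite gmulfM -phif; congr (_ * _); case: b => //=.
rewrite -gmulfV; congr (phi _).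
rewrite -[LHS]mulg1 -(mulgV (pres_gen x)) mulgA.
rewrite -[X in X * _]/(pres_mul _ _) pres_piM.
by rewrite (pres_piP _ [::]).2 ?mul1g //; exact: pres_eq_inv.
Qed.

End Presentation.

Section FreeGroup.
Variable I : choiceType.

Definition freegroup := pres (fun _ _ : word I => False).

HB.instance Definition _ := Group.on freegroup.

Definition fg_gen (i : I) : freegroup := pres_gen _ i.

Variables (K : groupType) (f : I -> K).

Definition fg_lift : freegroup -> K := pres_lift f.

Lemma fg_lift_gen i : fg_lift (fg_gen i) = f i.
Proof. exact: pres_lift_gen. Qed.

Lemma fg_lift_monoid_morphism : monoid_morphism fg_lift.
Proof. exact: pres_lift_monoid_morphism. Qed.

HB.instance Definition _ :=
  isUMagmaMorphism.Build freegroup K fg_lift fg_lift_monoid_morphism.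

End FreeGroup.

Section FreeProduct.
Variables G H : groupType.

(* The multiplication tables of G and of H; that formal inverses of letters are
   the letters of the inverses follows. *)
Inductive fp_rel : word (G + H) -> word (G + H) -> Prop :=
| fp_rel_l (a b : G) :
    fp_rel [:: (inl a, false); (inl b, false)] [:: (inl (a * b), false)]
| fp_rel_r (a b : H) :
    fp_rel [:: (inr a, false); (inr b, false)] [:: (inr (a * b), false)].

Definition freeprod := pres fp_rel.

HB.instance Definition _ := Group.on freeprod.

Definition fp_inl (a : G) : freeprod := pres_gen fp_rel (inl a).
Definition fp_inr (b : H) : freeprod := pres_gen fp_rel (inr b).

Lemma pres_genM (x y z : G + H) :
  fp_rel [:: (x, false); (y, false)] [:: (z, false)] ->
  pres_gen fp_rel z = pres_gen fp_rel x * pres_gen fp_rel y.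
Proof.
move=> xyz; rewrite -[RHS]/(pres_mul _ _) pres_piM.
by apply/pres_piP/pres_eq_sym/pres_eq_rel.
Qed.

Lemma fp_inlM : {morph fp_inl : a b / a * b}.
Proof. by move=> a b; apply: pres_genM; exact: fp_rel_l. Qed.

Lemma fp_inrM : {morph fp_inr : a b / a * b}.
Proof. by move=> a b; apply: pres_genM; exact: fp_rel_r. Qed.

Lemma morphM_morph1 (G1 G2 : groupType) (f : G1 -> G2) :
  {morph f : a b / a * b} -> f 1 = 1.
Proof. by move=> fM; apply: (mulgI (f 1)); rewrite -fM !mulg1. Qed.

HB.instance Definition _ := isUMagmaMorphism.Build G freeprod fp_inl
  (morphM_morph1 fp_inlM, fp_inlM).
HB.instance Definition _ := isUMagmaMorphism.Build H freeprod fp_inr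
  (morphM_morph1 fp_inrM, fp_inrM).

Variables (K : groupType) (f : UMagmaMorphism.type G K)
  (h : UMagmaMorphism.type H K).

Definition fp_copair (x : G + H) : K :=
  match x with inl a => f a | inr b => h b end.

Lemma fp_copair_respects : respects fp_rel fp_copair.
Proof.
move=> _ _ [] a b; rewrite /word_val !big_cons !big_nil /= !mulg1;
  by rewrite gmulfM.
Qed.

Definition fp_lift : freeprod -> K := pres_lift fp_copair.

Lemma fp_lift_inl a : fp_lift (fp_inl a) = f a.
Proof. exact: pres_lift_gen fp_copair_respects. Qed.

Lemma fp_lift_inr b : fp_lift (fp_inr b) = h b.
Proof. exact: pres_lift_gen fp_copair_respects. Qed.

Lemma fp_lift_monoid_morphism : monoid_morphism fp_lift.
Proof. exact: pres_lift_monoid_morphism fp_copair_respects. Qed.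

HB.instance Definition _ :=
  isUMagmaMorphism.Build freeprod K fp_lift fp_lift_monoid_morphism.

End FreeProduct.

Section MixedIdentity.
Variable G : groupType.

(* The free product of G with the free group on r generators. *)
Definition const_word (r : nat) := freeprod G (freegroup 'I_r).

Definition const_word_eval (r : nat) (w : const_word r) (g : 'I_r -> G) : G :=
  fp_lift (idfun : G -> G) (fg_lift g) w.

Definition mixed_identity (r : nat) (w : const_word r) : Prop :=
  w <> 1 /\ forall g : 'I_r -> G, const_word_eval w g = 1.

Lemma const_word_eval_unique (r : nat) (g : 'I_r -> G)
    (phi : UMagmaMorphism.type (const_word r) G) :
  (forall c : G, phi (fp_inl _ c) = c) ->
  (forall i : 'I_r, phi (fp_inr _ (fg_gen i)) = g i) ->
  forall w, phi w = const_word_eval w g.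
Proof.
move=> phic phix w; apply: pres_lift_unique => -[c|v] /=; first exact: phic.
exact: (@pres_lift_unique _ _ _ g (phi \o @fp_inr G (freegroup 'I_r))).
Qed.

End MixedIdentity.

Section PosetAutomorphisms.
Variables (d : Order.disp_t) (P : porderType d).

Record aut : Type := Aut {
  aut_fun :> P -> P;
  aut_bij : bijective aut_fun;
  aut_mono : {mono aut_fun : x y / x < y}
}.

HB.instance Definition _ := gen_eqMixin aut.
HB.instance Definition _ := gen_choiceMixin aut.

Lemma aut_ext (f g : aut) : f =1 g -> f = g.
Proof.
case: f g => [f fb fm] [g gb gm] /= /funext fg; case: _ / fg in gb gm *.
by congr Aut; exact: Prop_irrelevance.
Qed.

Definition aut_one : aut := @Aut idfun (Bijective (frefl _) (frefl _)) (fun=> frefl _).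

Lemma aut_mul_mono (f g : aut) : {mono f \o g : x y / x < y}.
Proof. by move=> x y /=; rewrite !aut_mono. Qed.

(* (f * g) x = f (g x) *)
Definition aut_mul (f g : aut) : aut :=
  Aut (bij_comp (aut_bij f) (aut_bij g)) (aut_mul_mono f g).

Lemma aut_inv_subproof (f : aut) : exists g : aut, cancel f g /\ cancel g f.
Proof.
have [g fK gK] := aut_bij f.
have gm : {mono g : x y / x < y} by move=> x y; rewrite -(aut_mono f) !gK.
by exists (Aut (Bijective gK fK) gm).
Qed.

Definition aut_inv (f : aut) : aut := sval (cid (aut_inv_subproof f)).

Lemma aut_invK (f : aut) : cancel f (aut_inv f).
Proof. by rewrite /aut_inv; case: cid => g []. Qed.

Lemma aut_invVK (f : aut) : cancel (aut_inv f) f.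
Proof. by rewrite /aut_inv; case: cid => g []. Qed.

Lemma aut_mulA : associative aut_mul.
Proof. by move=> f g h; exact: aut_ext. Qed.

Lemma aut_mul1 : left_id aut_one aut_mul.
Proof. by move=> f; exact: aut_ext. Qed.

Lemma aut_mulr1 : right_id aut_one aut_mul.
Proof. by move=> f; exact: aut_ext. Qed.

Lemma aut_mulV : left_inverse aut_one aut_inv aut_mul.
Proof. by move=> f; apply: aut_ext => x; exact: aut_invK. Qed.

Lemma aut_mulVr : right_inverse aut_one aut_inv aut_mul.
Proof. by move=> f; apply: aut_ext => x; exact: aut_invVK. Qed.

HB.instance Definition _ := isGroup.Build aut
  aut_mulA aut_mul1 aut_mulr1 aut_mulV aut_mulVr.

Definition homogeneous_poset : Prop :=
  forall (A B : {fset P}) (f : A -> B), bijective f ->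
    (forall x y : A, (val (f x) < val (f y)) = (val x < val y)) ->
    exists g : aut, forall x : A, g (val x) = val (f x).

Definition universal_poset : Prop :=
  forall (e : Order.disp_t) (Q : finPOrderType e),
    exists2 f : Q -> P, injective f & {mono f : x y / x < y}.

Definition random_poset : Prop :=
  [/\ countable [set: P], homogeneous_poset & universal_poset].

End PosetAutomorphisms.

(* Main.v *)
Require Import Defs.
From mathcomp Require Import all_boot all_order.
From HB Require Import structures.
From mathcomp Require Import finmap boolp.

(* By homogeneity it suffices to build finite partial isomorphisms realizing a
   nontrivial trajectory of some point under a reduced word with constants.
   Each application of a variable to a new point u may send it to any point v
   of a prescribed nonalgebraic 1-type over a finite set; the following
   constant c must then move v off finitely many earlier points and, when c
   separates a variable from its inverse, satisfy c v <> v.  Such a v exists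
   because an automorphism fixing every realization of one nonalgebraic type
   is trivial: it also fixes the realizations of the types obtained by
   successively dropping the lower and the upper constraints, then every point
   not above finitely many given ones, and these separate all points. *)

Set Implicit Arguments.
Unset Strict Implicit.
Unset Printing Implicit Defensive.

Import Order.TTheory.
Local Open Scope group_scope.
Local Open Scope order_scope.

(** * Finite partial isomorphisms and realizability of 1-types over finite sets *)

Section RandomPoset.
Variables (d : Order.disp_t) (P : porderType d).
Implicit Types (c : aut P) (A : seq (P * P)) (L U N F : seq P).

Lemma aut_le c : {mono c : x y / x <= y}.
Proof.
have [h cK _] := aut_bij c.
by move=> x y; rewrite !le_eqVlt aut_mono (can_eq cK).
Qed.

(** Comparing with [<=] rather than [<] makes the list, by antisymmetry, the graph of an injective
    function. *)
Definition partial_iso A : Prop :=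
  {in A &, forall p q, (p.1 <= q.1) = (p.2 <= q.2)}.

(** These are the obstructions from transitivity to a point [v] above [L], below [U] and
    incomparable to [N]: [n <= l] would force [n < v], and [u <= n] would force [v < n]. *)
Definition compatible L U N : Prop :=
  [/\ {in L & U, forall l u, l < u},
      {in L & N, forall l n, ~~ (n <= l)}
    & {in U & N, forall u n, ~~ (u <= n)}].

Definition realizes L U N v : Prop :=
  [/\ {in L, forall l, l < v}, {in U, forall u, v < u}
    & {in N, forall n, v >< n}].

Lemma partial_iso_extend A : homogeneous_poset P -> partial_iso A ->
  exists g : aut P, {in A, forall p, g p.1 = p.2}.
Proof.
move=> hom isoA.
pose X := [fset p.1 | p in A]%fset; pose Y := [fset p.2 | p in A]%fset.
have XY (x : X) : exists y : Y, (val x, val y) \in A.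
  have /imfsetP [[a b] /= abA ->] := valP x.
  have bY : b \in Y by apply/imfsetP; exists (a, b).
  by exists [` bY]%fset.
have YX (y : Y) : exists x : X, (val x, val y) \in A.
  have /imfsetP [[a b] /= abA ->] := valP y.
  have aX : a \in X by apply/imfsetP; exists (a, b).
  by exists [` aX]%fset.
have [f fA] := choice XY; have [h hA] := choice YX.
have fK : cancel f h.
  move=> x; apply/val_inj/le_anti.
  by rewrite (isoA _ _ (hA (f x)) (fA x)) (isoA _ _ (fA x) (hA (f x))) /= lexx.
have hK : cancel h f.
  move=> y; apply/val_inj/le_anti.
  by rewrite -(isoA _ _ (hA y) (fA (h y))) -(isoA _ _ (fA (h y)) (hA y)) /= lexx.
have [|g gE] := hom X Y f (Bijective fK hK).
  by move=> x y; rewrite !lt_leAnge (isoA _ _ (fA x) (fA y)) (isoA _ _ (fA y) (fA x)).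
exists g => -[a b] abA /=.
have aX : a \in X by apply/imfsetP; exists (a, b).
have := gE [` aX]%fset; rewrite /= => ->.
apply/le_anti; have faA := fA [` aX]%fset.
by rewrite -(isoA _ _ faA abA) -(isoA _ _ abA faA) /= lexx.
Qed.

(** A new point is adjoined to the finite poset on [L], [U] and [N]; universality embeds the result
    in [P], and homogeneity carries the copies of the old points back to the originals. *)
Lemma realization_exists L U N : homogeneous_poset P -> universal_poset P ->
  compatible L U N -> exists v, realizes L U N v.
Proof.
move=> hom univ [LU LN UN].
pose B := [fset x in L ++ U ++ N]%fset.
(* The new point [None] is above exactly the lower closure of [L] in [B] and below exactly the upper
   closure of [U]. *)
pose leQ (x y : option B) := match x, y with
  | Some a, Some b => val a <= val b
  | None, None => true
  | None, Some b => has (fun u => u <= val b) U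
  | Some a, None => has (fun l => val a <= l) L end.
have leQ_refl : reflexive leQ by case=> [x|] /=.
have leQ_anti : antisymmetric leQ.
  move=> [a|] [b|] //=; first by move=> /le_anti/val_inj ->.
    move=> /andP[/hasP[l lL al] /hasP[u uU ua]].
    by have := le_lt_trans (le_trans ua al) (LU _ _ lL uU); rewrite ltxx.
  move=> /andP[/hasP[u uU ua] /hasP[l lL al]].
  by have := le_lt_trans (le_trans ua al) (LU _ _ lL uU); rewrite ltxx.
have leQ_trans : transitive leQ.
  move=> [b|] [a|] [e|] //=.
  - exact: le_trans.
  - by move=> ab /hasP[l lL bl]; apply/hasP; exists l => //; exact: le_trans bl.
  - by move=> /hasP[u uU ub] be; apply/hasP; exists u => //; exact: le_trans be.
  - move=> /hasP[l lL al] /hasP[u uU ue].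
    exact: le_trans al (le_trans (ltW (LU _ _ lL uU)) ue).
pose Q : finPOrderType (Order.Disp tt tt) :=
  HB.pack (option B) (Order.Le_isPOrder.Build (Order.Disp tt tt) (option B)
    leQ_refl leQ_anti leQ_trans).
have [f f_inj f_lt] := univ _ Q.
have f_le (x y : option B) : (f x <= f y) = leQ x y.
  by rewrite le_eqVlt (inj_eq f_inj) f_lt -le_eqVlt.
have [|g gE] := @partial_iso_extend [seq (f (Some b), val b) | b : B] hom.
  by move=> _ _ /mapP[a _ ->] /mapP[b _ ->] /=; rewrite f_le.
have gB (b : B) : g (f (Some b)) = val b.
  by apply: (gE (f (Some b), val b)); apply: map_f; rewrite mem_enum.
have inB x : x \in L ++ U ++ N -> exists2 b : B, val b = x & g (f (Some b)) = x.
  move=> xB; have xB' : x \in B by rewrite in_fset.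
  by exists [` xB']%fset; last exact: gB.
exists (g (f None)); split=> [l lL|u uU|n nN].
- have [|b bl <-] := inB l; first by rewrite mem_cat lL.
  rewrite aut_mono lt_leAnge !f_le /= bl; apply/andP; split.
    by apply/hasP; exists l.
  apply/hasPn => u uU; apply/negP => ul.
  by have := le_lt_trans ul (LU _ _ lL uU); rewrite ltxx.
- have [|b bu <-] := inB u; first by rewrite !mem_cat uU orbT.
  rewrite aut_mono lt_leAnge !f_le /= bu; apply/andP; split.
    by apply/hasP; exists u.
  apply/hasPn => l lL; apply/negP => ul.
  by have := le_lt_trans ul (LU _ _ lL uU); rewrite ltxx.
- have [|b bn <-] := inB n; first by rewrite !mem_cat nN !orbT.
  rewrite /Order.comparable !aut_le !f_le /= bn negb_or.
  by apply/andP; split; apply/hasPn => x xS; [exact: UN | exact: LN].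
Qed.

Hypotheses (hom : homogeneous_poset P) (univ : universal_poset P).

(** Elements of [F] below a point of [L] or above a point of [U] cannot realize the type; all others
    can be added to [N]. *)
Lemma compatible_avoid L U N F : compatible L U N ->
  exists2 N', compatible L U N' &
    forall v, realizes L U N' v -> realizes L U N v /\ v \notin F.
Proof.
move=> [LU LN UN].
pose free x := ~~ has (fun l => x <= l) L && ~~ has (fun u => u <= x) U.
exists (N ++ [seq x <- F | free x]).
  split=> // x y xS; rewrite mem_cat => /orP[]; rewrite ?mem_filter; try by auto.
    by move=> /andP[/andP[/hasPn yL _] _]; exact: yL.
  by move=> /andP[/andP[_ /hasPn yU] _]; exact: yU.
move=> v [vL vU vN]; split.
  by split=> // n nN; apply: vN; rewrite mem_cat nN.
apply/negP => vF; have [vfree|] := boolP (free v).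
  by have := vN v; rewrite mem_cat mem_filter vfree vF orbT comparablexx => /(_ isT).
rewrite negb_and !negbK => /orP[/hasP[l /vL lv vl]|/hasP[u /vU vu uv]].
  by have := lt_le_trans lv vl; rewrite ltxx.
by have := lt_le_trans vu uv; rewrite ltxx.
Qed.

(** * Automorphisms fixing every realization of a type *)

Lemma fix_lt c v x : c v = v -> (v < c x) = (v < x).
Proof. by move=> {1}<-; rewrite aut_mono. Qed.

Lemma fix_gt c v x : c v = v -> (c x < v) = (x < v).
Proof. by move=> {1}<-; rewrite aut_mono. Qed.

Lemma fix_cmp c v x : c v = v -> (v >=< c x) = (v >=< x).
Proof. by move=> {1}<-; rewrite /Order.comparable !aut_le. Qed.

Lemma compatible_consL a L U N :
  {in U, forall u, a < u} -> {in N, forall n, ~~ (n <= a)} ->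
  compatible L U N -> compatible (a :: L) U N.
Proof.
by move=> aU aN [LU LN UN]; split=> // x y /predU1P[->|xL]; auto.
Qed.

Lemma compatible_consU a L U N :
  {in L, forall l, l < a} -> {in N, forall n, ~~ (a <= n)} ->
  compatible L U N -> compatible L (a :: U) N.
Proof.
move=> aL aN [LU LN UN]; split=> // x y; last by move=> /predU1P[->|xU]; auto.
by move=> xL /predU1P[->|yU]; auto.
Qed.

Lemma compatible_consN a L U N :
  {in L, forall l, ~~ (a <= l)} -> {in U, forall u, ~~ (u <= a)} ->
  compatible L U N -> compatible L U (a :: N).
Proof.
by move=> aL aU [LU LN UN]; split=> // x y xS /predU1P[->|yN]; auto.
Qed.

Lemma realizes_consL a L U N v :
  realizes (a :: L) U N v -> a < v /\ realizes L U N v.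
Proof.
move=> [vL vU vN]; split; first exact/vL/mem_head.
by split=> // x xL; apply: vL; rewrite inE xL orbT.
Qed.

Lemma realizes_consU a L U N v :
  realizes L (a :: U) N v -> v < a /\ realizes L U N v.
Proof.
move=> [vL vU vN]; split; first exact/vU/mem_head.
by split=> // x xU; apply: vU; rewrite inE xU orbT.
Qed.

Lemma realizes_consN a L U N v :
  realizes L U (a :: N) v -> a >< v /\ realizes L U N v.
Proof.
move=> [vL vU vN]; split; first by rewrite comparable_sym; exact/vN/mem_head.
by split=> // x xN; apply: vN; rewrite inE xN orbT.
Qed.

Lemma lt_ngeq (x y : P) : x < y -> ~~ (y <= x).
Proof. by move=> xy; rewrite (lt_geF xy). Qed.

Lemma incomp_nle (x y : P) : x >< y -> ~~ (x <= y) /\ ~~ (y <= x).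
Proof. by rewrite /Order.comparable negb_or => /andP. Qed.

Lemma nle_lt_trans (x y z : P) : ~~ (x <= z) -> y < z -> ~~ (x <= y).
Proof. by move=> xz yz; apply: contra xz => /le_lt_trans/(_ yz)/ltW. Qed.

Lemma lt_nle_trans (x y z : P) : x < y -> ~~ (x <= z) -> ~~ (y <= z).
Proof. by move=> xy; apply: contra => /(lt_le_trans xy)/ltW. Qed.

(* If c q <> q, some realization lies above exactly one of q and c q, so it
   is not fixed. *)
Lemma fix_below L U N c : compatible L U N ->
  (forall v, realizes L U N v -> c v = v) ->
  forall q, {in U, forall u, q < u} -> {in L, forall l, ~~ (q <= l)} ->
    {in N, forall n, ~~ (n <= q)} -> c q = q.
Proof.
move=> LUN cfix q qU qL qN.
have nUq : {in U, forall u, ~~ (u <= q)} by move=> u /qU/lt_ngeq.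
(* Fixed points compare to [c q] as they do to [q]. So [v1], above [q], and [v2], incomparable to
   [q], transfer the constraints from [q] to [c q], and the types below that mention [c q] are
   compatible. *)
have [v1 /realizes_consL[qv1 rv1]] :=
  realization_exists hom univ (compatible_consL qU qN LUN).
have [v2 /realizes_consN[qv2 rv2]] :=
  realization_exists hom univ (compatible_consN qL nUq LUN).
have cqv1 : c q < v1 by rewrite fix_gt ?cfix.
have cqU : {in U, forall u, c q < u}.
  by case: rv1 => _ v1U _ u /v1U; exact: lt_trans.
have nUcq : {in U, forall u, ~~ (u <= c q)} by move=> u /cqU/lt_ngeq.
have cqL : {in L, forall l, ~~ (c q <= l)}.
  case: (rv2) => v2L _ _ l /v2L; apply: nle_lt_trans.
  by move: qv2; rewrite comparable_sym -(fix_cmp q (cfix _ rv2)) => /incomp_nle[].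
have cqN : {in N, forall n, ~~ (n <= c q)}.
  by case: rv1 => _ _ v1N n /v1N/incomp_nle[_] /nle_lt_trans; exact.
apply/eqP/negPn/negP; rewrite eq_le negb_and => /orP[] nle.
- have [|v /realizes_consN[cqv /realizes_consL[qv rv]]] :=
      @realization_exists (q :: L) U (c q :: N) hom univ.
    apply: compatible_consN => //; last exact: compatible_consL.
    by move=> l /predU1P[->|] //; exact: cqL.
  by move: cqv; rewrite lt_comparable // fix_gt ?cfix.
- have [|v /realizes_consN[qv /realizes_consL[cqv rv]]] :=
      @realization_exists (c q :: L) U (q :: N) hom univ.
    apply: compatible_consN => //; last exact: compatible_consL.
    by move=> l /predU1P[->|] //; exact: qL.
  by move: qv; rewrite lt_comparable // -(fix_gt q (cfix _ rv)).
Qed.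

(** Order dual of [fix_below]: the separating realization lies below exactly one of [q] and
    [c q]. *)
Lemma fix_above L U N c : compatible L U N ->
  (forall v, realizes L U N v -> c v = v) ->
  forall q, {in L, forall l, l < q} -> {in U, forall u, ~~ (u <= q)} ->
    {in N, forall n, ~~ (q <= n)} -> c q = q.
Proof.
move=> LUN cfix q qL qU qN.
have nLq : {in L, forall l, ~~ (q <= l)} by move=> l /qL/lt_ngeq.
have [v1 /realizes_consU[qv1 rv1]] :=
  realization_exists hom univ (compatible_consU qL qN LUN).
have [v2 /realizes_consN[qv2 rv2]] :=
  realization_exists hom univ (compatible_consN nLq qU LUN).
have cqv1 : v1 < c q by rewrite fix_lt ?cfix.
have cqL : {in L, forall l, l < c q}.
  by case: rv1 => v1L _ _ l /v1L /lt_trans; exact.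
have nLcq : {in L, forall l, ~~ (c q <= l)} by move=> l /cqL/lt_ngeq.
have cqU : {in U, forall u, ~~ (u <= c q)}.
  case: (rv2) => _ v2U _ u /v2U /lt_nle_trans; apply.
  by move: qv2; rewrite comparable_sym -(fix_cmp q (cfix _ rv2)) => /incomp_nle[].
have cqN : {in N, forall n, ~~ (c q <= n)}.
  by case: rv1 => _ _ v1N n /v1N/incomp_nle[+ _]; exact: lt_nle_trans.
apply/eqP/negPn/negP; rewrite eq_le negb_and => /orP[] nle.
- have [|v /realizes_consN[qv /realizes_consU[cqv rv]]] :=
      @realization_exists L (c q :: U) (q :: N) hom univ.
    apply: compatible_consN => //; last exact: compatible_consU.
    by move=> u /predU1P[->|] //; exact: qU.
  by move: qv; rewrite gt_comparable // -(fix_lt q (cfix _ rv)).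
- have [|v /realizes_consN[cqv /realizes_consU[qv rv]]] :=
      @realization_exists L (q :: U) (c q :: N) hom univ.
    apply: compatible_consN => //; last exact: compatible_consU.
    by move=> u /predU1P[->|] //; exact: cqU.
  by move: cqv; rewrite gt_comparable // fix_lt ?cfix.
Qed.

Lemma fix_realizations L U N c : compatible L U N ->
  (forall v, realizes L U N v -> c v = v) -> c = 1.
Proof.
move=> LUN cfix.
(* The lower bounds are weakened to incomparability, which still meets the conditions of
   [fix_below]. *)
have fixU v : realizes [::] U (L ++ N) v -> c v = v.
  move=> [_ vU vN]; apply: (fix_below LUN cfix) => // x xS;
    by case: (@incomp_nle v x); rewrite ?vN ?mem_cat ?xS ?orbT.
have compU : compatible [::] U (L ++ N).
  case: LUN => LU _ UN; split=> // u n uU; rewrite mem_cat => /orP[nL|]; last exact: UN.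
  exact/lt_ngeq/LU.
pose M := U ++ L ++ N.
(* Dually for the upper bounds, leaving only incomparability to [M]. *)
have fixM v : realizes [::] [::] M v -> c v = v.
  move=> [_ _ vM]; apply: (fix_above compU fixU) => // x xS;
    by case: (@incomp_nle v x); rewrite ?vM // /M mem_cat xS ?orbT.
(* With no bounds left, [fix_below] only asks that [v] be above no point of [M]. *)
have fix_min v : {in M, forall x, ~~ (x <= v)} -> c v = v.
  by apply: (fix_below _ fixM) => //; split.
(* Take [v] below [x] and incomparable to [y] and to the points of [M] not above [x]. The other
   points of [M] are above [x], hence above [v], so [fix_min] applies. *)
have sep x y : ~~ (x <= y) -> exists v, [/\ c v = v, v < x & ~~ (v <= y)].
  move=> xy; pose M' := [seq z <- M | ~~ (x <= z)].
  have [|v [_ vx vN]] := @realization_exists [::] [:: x] (y :: M') hom univ.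
    by split=> // _ z /[!inE] /eqP-> /predU1P[->//|]; rewrite mem_filter => /andP[].
  have {}vx : v < x by apply: vx; rewrite mem_head.
  exists v; split=> //; last by have /incomp_nle[] := vN y (mem_head _ _).
  apply: fix_min => z zM; have [xz|xz] := boolP (x <= z).
    exact/lt_ngeq/(lt_le_trans vx).
  by case: (@incomp_nle v z); rewrite // vN // inE mem_filter xz zM orbT.
(* A fixed point is below [c x] exactly when it is below [x], so none separates the two. *)
apply: aut_ext => x /=; apply/eqP/negPn/negP; rewrite eq_le negb_and.
move=> /orP[] /sep[v [cv vx /negP]]; apply.
  by move: vx; rewrite fix_lt // => /ltW.
by rewrite ltW // fix_lt.
Qed.

(** * One-point extensions of partial isomorphisms *)

Lemma partial_iso_swap A :
  partial_iso A -> partial_iso [seq (p.2, p.1) | p <- A].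
Proof. by move=> isoA _ _ /mapP[p pA ->] /mapP[q qA ->] /=; rewrite isoA. Qed.

Lemma partial_iso_lt A : partial_iso A ->
  {in A &, forall p q, (p.1 < q.1) = (p.2 < q.2)}.
Proof. by move=> isoA p q pA qA; rewrite !lt_leAnge !isoA. Qed.

(** As [u] is new to the domain, [v] need only realize a nonalgebraic type. Avoiding the preimage of
    [F] under [c] refines it to another such type, and a nontrivial [c] moves some realization of
    that one. *)
Lemma partial_iso_extend_moving A u c F : partial_iso A ->
  {in A, forall p, p.1 != u} ->
  exists v, [/\ partial_iso ((u, v) :: A), c v \notin F & c != 1 -> c v != v].
Proof.
move=> isoA Au; have ltA := partial_iso_lt isoA.
(* The type of [u] over the domain of [A], transported to the range. *)
pose L := [seq p.2 | p <- A & p.1 < u]; pose U := [seq p.2 | p <- A & u < p.1].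
pose N := [seq p.2 | p <- A & p.1 >< u].
have LUN : compatible L U N.
  split=> _ _ /mapP[p + ->] /mapP[q + ->]; rewrite !mem_filter;
    move=> /andP[pu pA] /andP[qu qA].
  - by rewrite -ltA //; exact: lt_trans pu qu.
  - rewrite -isoA //; have /incomp_nle[qnu _] := qu; exact: nle_lt_trans pu.
  - rewrite -isoA //; have /incomp_nle[_ unq] := qu; exact: lt_nle_trans unq.
have [N' LUN' N'P] := compatible_avoid [seq (c^-1) x | x <- F] LUN.
have [v rv cv] : exists2 v, realizes L U N' v & c != 1 -> c v != v.
  have [->|c1] := eqVneq c 1.
    by have [v rv] := realization_exists hom univ LUN'; exists v.
  apply: contrapT => nex; case/eqP: c1; apply: (fix_realizations LUN') => v rv.
  by apply/eqP/negPn/negP => cv; apply: nex; exists v.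
have [[vL vU vN] vF] := N'P v rv.
exists v; split=> //; last first.
  by apply: contra vF => cvF; apply/mapP; exists (c v); rewrite ?aut_invK.
have vA p : p \in A -> ((u <= p.1) = (v <= p.2)) * ((p.1 <= u) = (p.2 <= v)).
  move=> pA; have := Au p pA; case: (comparableP p.1 u) => // pu _.
  - have pv : p.2 < v by apply: vL; apply/map_f; rewrite mem_filter pu.
    by rewrite (lt_geF pv) (ltW pv).
  - have pv : v < p.2 by apply: vU; apply/map_f; rewrite mem_filter pu.
    by rewrite (lt_geF pv) (ltW pv).
  - have /incomp_nle[vp pv] : v >< p.2.
      by apply: vN; apply/map_f; rewrite mem_filter pu.
    by rewrite (negbTE vp) (negbTE pv).
move=> p q /predU1P[->|pA] /predU1P[->|qA] /=; rewrite ?lexx ?vA //.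
exact: isoA.
Qed.

End RandomPoset.

(** * Reduced forms of words with constants *)

Section ReducedWords.
Variables (G : groupType) (r : nat).

(* ((i, e), c) stands for c x_i^(+-1), with x_i inverted when e is true; lists
   are read from right to left, in the order in which they act on points. *)
Definition syllable : Type := ('I_r * bool) * G.

Definition letter (K : groupType) (f : 'I_r -> K) (a : 'I_r * bool) : K :=
  if a.2 then (f a.1)^-1 else f a.1.

Definition syl_val (K : groupType) (f : 'I_r -> K) (h : G -> K)
    (t : seq syllable) : K :=
  foldr (fun s w => w * (h s.2 * letter f s.1)) 1 t.

(** Since [s] acts first, [s.2] is the constant standing between the two letters. *)
Definition no_cancel (s s' : syllable) : bool :=
  ~~ [&& s.1.1 == s'.1.1, s.1.2 != s'.1.2 & s.2 == 1].

Definition reduced (t : seq syllable) : bool := sorted no_cancel t.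

Lemma pres_pi_val (X : choiceType) (R : word X -> word X -> Prop) (u : word X) :
  pres_pi R u = word_val (pres_gen R) u.
Proof.
rewrite /word_val; elim: u => [|[x b] u IHu]; first by rewrite big_nil.
rewrite big_cons -IHu -[_ :: u]/([:: (x, b)] ++ u) -pres_piM.
congr (_ * _); case: b => //=.
apply: (mulIg (pres_gen R x)); rewrite mulVg -[LHS]/(pres_mul _ _) pres_piM.
exact/pres_piP/(pres_eq_inv R x true).
Qed.

Notation cword := (const_word G r).
Definition cvar (i : 'I_r) : cword := fp_inr G (fg_gen i).
Definition cconst (c : G) : cword := fp_inl (freegroup 'I_r) c.

Lemma const_word_ind (S : cword -> Prop) : S 1 ->
  (forall w c, S w -> S (w * cconst c)) ->
  (forall w a, S w -> S (w * letter cvar a)) ->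
  forall w, S w.
Proof.
move=> S1 Sc Sx.
have Sinr (v : freegroup 'I_r) w : S w -> S (w * fp_inr G v).
  rewrite -[v]pres_reprK pres_pi_val /word_val.
  elim: (repr v) w => [|[i b] u IHu] w Sw; first by rewrite big_nil gmulf1 mulg1.
  rewrite big_cons gmulfM mulgA; apply: IHu.
  by have := Sx w (i, b) Sw; rewrite /letter; case: b => //=; rewrite gmulfV.
move=> w; rewrite -[w]pres_reprK pres_pi_val.
suff Sval u w' : S w' -> S (w' * word_val (pres_gen _) u).
  by have := Sval (repr w) 1 S1; rewrite mul1g.
rewrite /word_val; elim: u w' => [|[x b] u IHu] w' Sw'; first by rewrite big_nil mulg1.
rewrite big_cons mulgA; apply: IHu.
case: x => [c|v]; case: b => /=.
- by have := Sc w' c^-1 Sw'; rewrite /cconst gmulfV.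
- exact: Sc.
- by have := Sinr v^-1 w' Sw'; rewrite gmulfV.
- exact: Sinr.
Qed.

Lemma reduced_form (w : cword) :
  exists t c, reduced t /\ w = syl_val cvar cconst t * cconst c.
Proof.
elim/const_word_ind: w => [|w a [t [c [tred ->]]]|w a [t [c [tred ->]]]].
- by exists [::], 1; rewrite /cconst gmulf1 mul1g.
- by exists t, (c * a); rewrite /cconst gmulfM mulgA.
have [ared|] := boolP (reduced ((a, c) :: t)).
  by exists ((a, c) :: t), 1; rewrite /cconst gmulf1 mulg1 /= mulgA.
case: t tred => [//|[a' c'] t] tred; rewrite /reduced /= negb_and.
move: (tred) => /= -> /=; rewrite orbF negbK /= => /and3P[/eqP a1 a2 /eqP ->].
(* The new letter cancels the head letter [a'], so the constant [c'] becomes the trailing one. *)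
exists t, c'; split; first exact: path_sorted tred.
rewrite /cconst gmulf1 mulg1 -!mulgA; congr (_ * _).
suff -> : letter cvar a' * letter cvar a = 1 by rewrite mulg1.
by move: a1 a2; rewrite /letter => ->; case: a.2 a'.2 => [] []; rewrite // (mulVg, mulgV).
Qed.

Lemma const_word_eval_syl (g : 'I_r -> G) t c :
  const_word_eval (syl_val cvar cconst t * cconst c) g = syl_val g id t * c.
Proof.
pose ev : UMagmaMorphism.type cword G := fp_lift (idfun : G -> G) (fg_lift g).
have evc a : ev (cconst a) = a by exact: fp_lift_inl.
have evx i : ev (cvar i) = g i by apply: etrans (fp_lift_inr _ _ _) (fg_lift_gen _ _).
rewrite -[LHS]/(ev _) gmulfM evc; congr (_ * _).
elim: t => [|[[i b] c'] t IHt] /=; first exact: gmulf1.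
rewrite !gmulfM IHt evc /letter /=; congr (_ * (_ * _)).
by case: b; rewrite ?gmulfV evx.
Qed.

End ReducedWords.

(** * Trajectories of points under reduced words *)

Section Path.
Variables (d : Order.disp_t) (P : porderType d) (r : nat).
Hypotheses (hom : homogeneous_poset P) (univ : universal_poset P).

(** Induction along the trajectory: [Gam] records the values already prescribed for each variable
    and [u] is the current point, at which the next letter is still undefined. *)
Lemma reduced_avoid (t : seq (syllable (aut P) r)) (Gam : 'I_r -> seq (P * P))
    (u : P) (F : seq P) :
  reduced t -> (forall i, partial_iso (Gam i)) ->
  (if t is ((i, e), _) :: _ return Prop
   then {in Gam i, forall p, (if e then p.2 else p.1) != u} else u \notin F) ->
  exists g : 'I_r -> aut P, (forall i, {in Gam i, forall p, g i p.1 = p.2}) /\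
    syl_val g id t u \notin F.
Proof.
elim: t Gam u => [|[[i e] c] t IHt] Gam u tred isoGam.
  move=> uF; have [g gE] := choice (fun i => partial_iso_extend hom (isoGam i)).
  by exists g.
move=> uGam.
pose A := if e then [seq (p.2, p.1) | p <- Gam i] else Gam i.
have isoA : partial_iso A by rewrite /A; case: (e); [exact: partial_iso_swap|].
have uA : {in A, forall p, p.1 != u}.
  by move: uGam; rewrite /A; case: (e) => // uG _ /mapP[p pG ->]; exact: uG.
(* All points used so far; a new point outside them leaves every previously recorded pair
   harmless. *)
pose pts := flatten [seq [seq p.1 | p <- Gam j] ++ [seq p.2 | p <- Gam j] | j : 'I_r].
have ptsP j p (b : bool) : p \in Gam j -> (if b then p.2 else p.1) \in pts.
  move=> pG; apply/flatten_mapP; exists j; first by rewrite mem_enum.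
  by rewrite mem_cat; case: b; rewrite map_f ?orbT.
have [v [isoAv + cv]] := partial_iso_extend_moving hom univ c (u :: pts ++ F) isoA uA.
rewrite inE mem_cat !negb_or => /and3P[cvu cvpts cvF].
pose Gam' j := if j == i then (if e then (v, u) else (u, v)) :: Gam i else Gam j.
have isoGam' j : partial_iso (Gam' j).
  rewrite /Gam'; case: eqVneq => _ //; move: isoAv; rewrite /A; case: (e) => //.
  by move=> /partial_iso_swap /=; rewrite -map_comp map_id_in // => -[].
have [|g [gE gF]] := IHt Gam' (c v) (path_sorted tred) isoGam'.
  case: t tred {IHt} => [//|[[i' e'] c'] t] /= /andP[nc _] p.
  have nold : p \in Gam i' -> (if e' then p.2 else p.1) != c v.
    by move=> /ptsP-/(_ e'); apply: contraTneq => ->.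
  rewrite /Gam'; case: (eqVneq i' i) => // ii'; rewrite inE => /predU1P[->|]; last first.
    by rewrite -ii'.
  (* The pair just added can only interfere through [v] when the next letter inverts the current
     one; reducedness then gives [c != 1]. *)
  have : e != e' -> c v != v.
    move=> ee'; apply: cv; apply/eqP => c1; case/negP: nc.
    by apply/and3P; split=> //; exact/eqP.
  by case: (e); case: (e') => /= cvv; rewrite eq_sym // cvv.
exists g; split=> [j p pG|].
  by apply: gE; rewrite /Gam'; case: eqVneq pG => [->|//]; rewrite inE => ->; rewrite orbT.
have {gE} := gE i; rewrite /Gam' eqxx => /(_ _ (mem_head _ _)) gv.
have -> : syl_val g id ((i, e, c) :: t) u =
  syl_val g id t (c (letter g (i, e) u)) by [].
suff -> : letter g (i, e) u = v by [].
rewrite /letter; move: gv; case: (e) => //= <-; exact: aut_invK.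
Qed.

End Path.

Theorem corollary4p3p2 (d : Order.disp_t) (P : porderType d)
    (hP : random_poset P) (r : nat) (w : const_word (aut P) r) :
  ~ mixed_identity w.
Proof.
case: hP => _ hom univ [w1 wid].
have [t [c [tred wE]]] := reduced_form w.
have eval_c g : syl_val g id t * c = 1.
  by rewrite -const_word_eval_syl -wE.
case: t tred wE eval_c => [|[[i e] c'] t] tred wE eval_c.
  apply: w1; rewrite wE mul1g.
  by have := eval_c (fun=> 1); rewrite /= mul1g => ->; exact: gmulf1.
(* The empty type provides a starting point [v]. The trailing constant sends it to [c v], from where
   the other syllables are made to end away from [v]. *)
have [v _] : exists v : P, realizes [::] [::] [::] v by exact: realization_exists.
have [//|//|g [_ /negP]] :=
  reduced_avoid hom univ (Gam := fun=> [::]) (u := c v) (F := [:: v]) tred.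
apply; rewrite inE -[X in X == _]/((syl_val g id _ * c) v).
by rewrite eval_c eqxx.
Qed.
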